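(* Let $\mathbf A\in\mathbb R^{n\times d}$ (rank $d$) have a nondegenerate optimal design $\mathbf p^\star$. With $V,T^\star,D,h,\varrho,\zeta$ as defined in the context: (i) $D$ is open in $V$ and convex; $h$ is $C^\infty$ and strictly convex on $D$; and $h$ is closed, i.e. its sublevel sets $\{\mathbf p\in D:h(\mathbf p)\le c\}$ are closed in $\mathbb R^n$. (ii) $\langle\nabla f(\mathbf p^\star),\boldsymbol\delta\rangle=0$ for every $\boldsymbol\delta\in T^\star$; consequently $\mathbf p^\star$ is the unique minimizer of $h$ over all of $D$. (iii) For every $\mathbf p\in D$: $h(\mathbf p)\ge f^\star+\zeta(\varrho(\mathbf p))$.
   Context: $\mathbf A$ has rows $\mathbf a_1,\dots,\mathbf a_n$. For $\mathbf p\in\mathbb R^n$, $\mathbf M(\mathbf p)=\sum_ip_i\mathbf a_i\mathbf a_i^\top$; when $\mathbf M(\mathbf p)\succ0$, $v_i(\mathbf p)=\mathbf a_i^\top\mathbf M(\mathbf p)^{-1}\mathbf a_i$, $f(\mathbf p)=-\log\det\mathbf M(\mathbf p)$. $\Delta_n$ is the probability simplex. An optimal design $\mathbf p^\star$ minimizes $f$ over $\Delta_n$; $f^\star=f(\mathbf p^\star)$, $\mathbf M^\star=\mathbf M(\mathbf p^\star)$, $S^\star=\{i:v_i(\mathbf p^\star)=d\}$. It is nondegenerate if $\operatorname{supp}\mathbf p^\star=S^\star$ (with $v_i(\mathbf p^\star)<d$ for $i\notin S^\star$) and $\{\mathbf a_i\mathbf a_i^\top\}_{i\in S^\star}$ are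 linearly independent. $V=\{\mathbf p\in\mathbb R^n:\operatorname{supp}\mathbf p\subseteq S^\star,\sum_ip_i=1\}$; $T^\star=\{\boldsymbol\delta\in\mathbb R^n:\operatorname{supp}\boldsymbol\delta\subseteq S^\star,\sum_i\delta_i=0\}$; $D=\{\mathbf p\in V:\mathbf M(\mathbf p)\succ0\}$ (negative coordinates allowed); $h=f|_D$. $\varrho(\mathbf p)=\|(\mathbf M^\star)^{-1/2}(\mathbf M(\mathbf p)-\mathbf M^\star)(\mathbf M^\star)^{-1/2}\|_F$; $\zeta(t)=t-\log(1+t)$ for $t\ge0$. *)

(* Defs.v *)
From HB Require Import structures.
From mathcomp Require Import all_boot all_order all_algebra.
From mathcomp Require Import all_classical all_reals all_analysis.

Set Implicit Arguments.
Unset Strict Implicit.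
Unset Printing Implicit Defensive.

Import Order.TTheory GRing.Theory Num.Theory.
Import numFieldNormedType.Exports.

Local Open Scope classical_set_scope.
Local Open Scope ring_scope.

Section Matrices.
Context {R : realType} {d : nat}.
Implicit Types M X : 'M[R]_d.

Definition posdef M : Prop :=
  M^T = M /\ forall x : 'rV[R]_d, x != 0 -> 0 < (x *m M *m x^T) 0 0.

(* M^(-1/2): the positive definite X with X^2 = M^-1. It exists and is unique
   when M is positive definite; the default value 0 is irrelevant there. *)
Definition inv_sqrtmx M : 'M[R]_d :=
  xget 0 [set X | posdef X /\ X *m X = invmx M].

Definition frobenius_norm M : R := Num.sqrt (\sum_i \sum_j M i j ^+ 2).

End Matrices.

Section Analysis.
Context {R : realType} {n : nat}.
Notation vec := 'rV[R]_n.
Implicit Types (E V T : set vec) (g : vec -> R) (p : vec).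

Definition open_in V E := exists U : set vec, open U /\ E = V `&` U.

Definition strictly_convex_on E g :=
  forall p q (t : R), E p -> E q -> p != q -> 0 < t < 1 ->
    g (t *: p + (1 - t) *: q) < t * g p + (1 - t) * g q.

Definition closed_on E g :=
  forall c : R, closed [set p | E p /\ g p <= c].

Definition iter_derive (s : seq vec) g : vec -> R :=
  foldr (fun delta u => 'D_delta u) g s.

(* C^infinity on a relatively open subset E of an affine subspace with
   direction T: directional derivatives of all orders, along arbitrary
   directions of T, exist and are continuous on E. Such derivatives at points
   of E only depend on the values of g on E. *)
Definition smooth_on T E g :=
  forall s : seq vec, (forall delta, delta \in s -> T delta) ->
    {within E, continuous (iter_derive s g)} /\
    (forall p delta, E p -> T delta -> derivable (iter_derive s g) p delta).

Definition gradient g p : vec := \row_i 'D_(delta_mx 0 i) g p.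

Definition inner (x y : vec) : R := \sum_i x 0 i * y 0 i.

Definition is_minimizer E g p := E p /\ forall q, E q -> g p <= g q.

End Analysis.

Section OptimalDesign.
Context {R : realType} {n d : nat} (A : 'M[R]_(n, d)).
Implicit Types p pstar : 'rV[R]_n.

(* The i-th row of A is the vector a_i; this is the d x d matrix a_i a_i^T. *)
Definition rank1 (i : 'I_n) : 'M[R]_d := (row i A)^T *m row i A.

Definition info p : 'M[R]_d := \sum_i p 0 i *: rank1 i.

Definition vscore p (i : 'I_n) : R :=
  (row i A *m invmx (info p) *m (row i A)^T) 0 0.

(* Only meaningful where info p is positive definite. *)
Definition objective p : R := - ln (\det (info p)).

Definition supp p : {set 'I_n} := [set i | p 0 i != 0]%SET.

Definition simplex : set 'rV[R]_n :=
  [set p | (forall i, 0 <= p 0 i) /\ \sum_i p 0 i = 1].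

(* Minimization over the simplex of -log det M(p), which is +oo (and not the
   value of objective) where M(p) is not positive definite. *)
Definition optimal_design pstar :=
  is_minimizer (simplex `&` [set p | posdef (info p)]) objective pstar.

Definition Sstar pstar : {set 'I_n} := [set i | vscore pstar i == d%:R]%SET.

Definition nondegenerate_design pstar :=
  [/\ supp pstar = Sstar pstar,
      forall i, i \notin Sstar pstar -> vscore pstar i < d%:R &
      free [seq rank1 i | i in Sstar pstar]].

Definition Vaff pstar : set 'rV[R]_n :=
  [set p | supp p \subset Sstar pstar /\ \sum_i p 0 i = 1].

Definition Tstar pstar : set 'rV[R]_n :=
  [set delta | supp delta \subset Sstar pstar /\ \sum_i delta 0 i = 0].

Definition Dom pstar : set 'rV[R]_n :=
  [set p | Vaff pstar p /\ posdef (info p)].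

Definition hfun pstar : 'rV[R]_n -> R := objective \_ (Dom pstar).

Definition rho pstar p : R :=
  let W := inv_sqrtmx (info pstar) in
  frobenius_norm (W *m (info p - info pstar) *m W).

End OptimalDesign.

Definition zeta {R : realType} (t : R) : R := t - ln (1 + t).

(* Main.v *)
(* Everything rests on one inequality for positive definite M0 and M. Put
   W = M0^(-1/2) and let x_i be the eigenvalues of X = W (M - M0) W, so that
   W M W = 1 + X. The Bregman divergence of -log det is then
     tr (M0^-1 (M - M0)) - log det M + log det M0
       = sum_i (x_i - log (1 + x_i)) >= zeta (||X||_F);
   the last step holds because zeta t / t^2 is nonincreasing. With
   M0 = info pstar the trace term is sum_i (p_i - pstar_i) v_i(pstar), which
   vanishes on V since v_i = d on the support: this is (iii), and it makes pstar
   a minimizer. Strict convexity is the same inequality based at a convex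
   combination, where the two trace terms cancel; linear independence of the
   a_i a_i^T makes it strict and hence the minimizer unique. Sublevel sets are
   closed because on V they are cut out by the closed conditions that info p is
   positive semidefinite and det (info p) >= exp (-c). *)
Require Import Defs.
From HB Require Import structures.
From mathcomp Require Import all_boot all_order all_algebra.
From mathcomp Require Import all_classical all_reals all_analysis.
From mathcomp Require Import complex lra ring.

Set Implicit Arguments.
Unset Strict Implicit.
Unset Printing Implicit Defensive.

Import Order.TTheory GRing.Theory Num.Theory.
Import numFieldNormedType.Exports.

Local Open Scope classical_set_scope.
Local Open Scope ring_scope.

(** * Real spectral theorem *)

Lemma mulmx_tr_gt0 (R : realDomainType) n (v : 'rV[R]_n) :
  v != 0 -> 0 < (v *m v^T) 0 0.
Proof.
move=> v0; rewrite mxE lt_def sumr_ge0 ?andbT; last first.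
  by move=> i _; rewrite mxE -expr2 sqr_ge0.
apply: contra v0; rewrite psumr_eq0 => [/allP h|i _]; last first.
  by rewrite mxE -expr2 sqr_ge0.
apply/eqP/rowP => i; have := h i (mem_index_enum _).
by rewrite !mxE -expr2 sqrf_eq0 => /eqP.
Qed.

Section SymmetricEigenvalue.
Local Open Scope sesquilinear_scope.

(** The complexification of M is Hermitian and has an eigenvector v over the closed field R[i].
    Evaluating v M v^* in two ways gives a v v^* = a^* v v^*, so the eigenvalue a is real, and being
    a root of the characteristic polynomial descends to R. *)
Lemma sym_eigenvalue (R : rcfType) n (M : 'M[R]_n.+1) :
  M^T = M -> exists a, eigenvalue M a.
Proof.
move=> Msym; pose MC := map_mx (real_complex R) M.
have [a ea] := eigenvalue_closed MC isT.
have [v vM v0] := eigenvalueP ea.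
have MCh : MC ^t* = MC.
  apply/matrixP => i j; rewrite !mxE -{2}Msym mxE.
  exact: conjc_real.
have ar : a^* = a.
  have vv0 : (v *m v ^t*) 0 0 != 0.
    by rewrite -dotmxE dnorm_eq0.
  have : (v *m MC *m v ^t*) = (v *m (v *m MC)^t*).
    by rewrite trmx_mul map_mxM MCh mulmxA.
  rewrite vM linearZ/= map_mxZ -scalemxAl -scalemxAr => /matrixP/(_ 0 0).
  by rewrite [LHS]mxE [RHS]mxE => /(mulIf vv0).
exists (complex.Re a).
move: ea; rewrite !eigenvalue_root_char.
have -> : a = real_complex R (complex.Re a).
  by apply/esym/RRe_real; apply/CrealP.
by rewrite /MC -map_char_poly fmorph_root.
Qed.

End SymmetricEigenvalue.

(* Q is the Householder reflection exchanging u and the first basis vector. *)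
Lemma unit_vector_reflection (R : realFieldType) n (u : 'rV[R]_n.+1) :
  u *m u^T = 1%:M ->
  exists Q : 'M[R]_n.+1, [/\ Q^T = Q, Q *m Q = 1%:M & delta_mx 0 0 *m Q = u].
Proof.
move=> uu; pose e : 'rV[R]_n.+1 := delta_mx 0 0.
have [->|ue] := eqVneq u e.
  by exists 1%:M; rewrite trmx1 mul1mx mulmx1.
pose w := u - e; pose s := (w *m w^T) 0 0.
have s0 : s != 0 by rewrite gt_eqF// mulmx_tr_gt0// subr_eq0.
have ww : w *m w^T = s%:M by rewrite [LHS]mx11_scalar.
have ee : e *m e^T = 1%:M.
  by rewrite trmx_delta mul_delta_mx; apply/matrixP => i j; rewrite !ord1 !mxE.
(* Both u and e have norm 1, so s = |u - e|^2 = 2 (1 - e u^T). This value makes the reflection along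
   w send e to e + w = u. *)
have ew : e *m w^T = (- (s / 2))%:M.
  have eu : e *m u^T = u *m e^T.
    by rewrite -[u in RHS]trmxK -trmx_mul [e *m _]mx11_scalar tr_scalar_mx.
  have h : s%:M = 2 *: (1%:M - e *m u^T).
    rewrite -ww /w linearB/= !mulmxBl !mulmxBr uu ee -eu.
    by rewrite scaler_nat mulr2n opprB.
  rewrite /w linearB/= mulmxBr ee -opprB [s / 2]mulrC raddfN/=; congr (- _).
  by rewrite -scale_scalar_mx h scalerA mulVf// scale1r.
have ->: u = e + w by rewrite addrC subrK.
clearbody s w; exists (1%:M - (2 / s) *: (w^T *m w)); split.
- by rewrite linearB/= trmx1 linearZ/= trmx_mul trmxK.
- rewrite mulmxBl !mulmxBr !mul1mx mulmx1 -scalemxAl -scalemxAr.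
  have -> : w^T *m w *m (w^T *m w) = s *: (w^T *m w).
    by rewrite mulmxA -(mulmxA _ w) ww mul_mx_scalar -scalemxAl.
  rewrite !scalerA; have -> : 2 / s * (2 / s) * s = 2 / s + 2 / s by field.
  by rewrite scalerDl opprB addrK subrK.
- rewrite mulmxBr mulmx1 -scalemxAr mulmxA ew mul_scalar_mx scalerA.
  by rewrite mulrN mulrC mulrA divfK// divff ?pnatr_eq0// scaleN1r opprK.
Qed.

(** Induction on the size. A reflection Q sends the first basis vector to a unit eigenvector, so the
    first row of N = Q M Q is zero off the diagonal. By symmetry so is its first column, and the
    induction hypothesis applies to the remaining block. The rows of P are the eigenvectors. *)
Theorem real_spectral (R : rcfType) n (M : 'M[R]_n) : M^T = M ->
  exists (P : 'M[R]_n) (x : 'rV[R]_n),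
    P *m P^T = 1%:M /\ M = P^T *m diag_mx x *m P.
Proof.
elim: n M => [|n IHn] M Msym.
  by exists 1%:M, 0; split; apply/matrixP => -[].
have [a /eigenvalueP[v vM v0]] := sym_eigenvalue Msym.
have vv := mulmx_tr_gt0 v0; set c := _ 0 0 in vv.
pose u := (Num.sqrt c)^-1 *: v.
have uM : u *m M = a *: u by rewrite -scalemxAl vM !scalerA mulrC.
have uu : u *m u^T = 1%:M.
  rewrite linearZ/= -scalemxAl -scalemxAr scalerA [v *m _]mx11_scalar.
  by rewrite scale_scalar_mx -/c -invfM -expr2 sqr_sqrtr ?ltW// mulVf ?gt_eqF.
have [Q [Qsym QQ eQ]] := unit_vector_reflection uu.
pose N : 'M[R]_(1 + n) := Q *m M *m Q.
have Nsym : N^T = N by rewrite !trmx_mul Msym Qsym mulmxA.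
have eN : delta_mx 0 0 *m N = a *: (delta_mx 0 0 : 'rV[R]_(1 + n)).
  by rewrite !mulmxA eQ uM -scalemxAl -eQ -mulmxA QQ mulmx1.
have MN : M = Q *m N *m Q.
  by rewrite /N !mulmxA QQ mul1mx -!mulmxA QQ mulmx1.
clearbody N; have N0 j : N 0 j = (a *: (delta_mx 0 0 : 'rV[R]_(1 + n))) 0 j.
  by rewrite -eN -rowE !mxE.
have Nul : ulsubmx N = a%:M.
  apply/matrixP => i j; rewrite !ord1 !mxE.
  rewrite (_ : lshift n 0 = 0); last exact: ord_inj.
  by rewrite N0 !mxE eqxx mulr1n mulr1.
have Nur : ursubmx N = 0.
  apply/matrixP => i j; rewrite !ord1 !mxE.
  rewrite (_ : lshift n 0 = 0); last exact: ord_inj.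
  by rewrite N0 !mxE /= mulr0.
have NE : N = block_mx a%:M 0 0 (drsubmx N).
  rewrite -[LHS]submxK Nul Nur; congr block_mx.
  by rewrite -Nsym -trmx_ursub Nur trmx0.
have [|P [x [PP NP]]] := IHn (drsubmx N); first by rewrite trmx_drsub Nsym.
pose B : 'M[R]_(1 + n) := block_mx 1%:M 0 0 P.
have BB : B *m B^T = 1%:M.
  rewrite /B tr_block_mx !trmx0 trmx1 mulmx_block !mulmx0 !mul0mx !addr0 add0r.
  by rewrite mulmx1 PP -scalar_mx_block.
have BN : B^T *m diag_mx (row_mx a%:M x) *m B = N.
  rewrite [RHS]NE NP diag_mx_row /B tr_block_mx !trmx0 trmx1 !mulmx_block.
  rewrite !mulmx0 !mul0mx !addr0 !add0r !mulmx1 !mul1mx !mul0mx.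
  by congr block_mx; apply/matrixP => i j; rewrite !ord1 !mxE.
exists (B *m Q), (row_mx a%:M x); rewrite trmx_mul Qsym MN -BN !mulmxA.
by split=> //; rewrite -(mulmxA B) QQ mulmx1.
Qed.

(** * The function zeta *)

Lemma is_derive_ge0_le (R : realType) (f df : R -> R) (a b : R) : a <= b ->
  (forall x, a <= x <= b -> is_derive x 1 f (df x)) ->
  (forall x, a <= x <= b -> 0 <= df x) -> f a <= f b.
Proof.
move=> ab fd df0; rewrite -subr_ge0.
have [x xab|//|x + ->] := @MVT_segment _ f df a b ab.
- move: xab; rewrite in_itv/= => /andP[/ltW ax /ltW xb].
  by apply: fd; rewrite ax.
- apply: derivable_within_continuous => x; rewrite in_itv/= => /fd fx.
  exact: ex_derive.
- by rewrite in_itv/= => xab; rewrite mulr_ge0 ?subr_ge0 ?df0.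
Qed.

Lemma is_derive_inv (R : realType) (x : R) : x != 0 ->
  is_derive x 1 (@GRing.inv R) (- x ^- 2).
Proof.
move=> x0; have dx : derivable (@id R) x 1 by [].
apply: DeriveDef; first exact: (derivableV x0 dx).
by have := deriveV x0 dx; rewrite derive_id scaler1 => <-.
Qed.

(** The difference of the two sides vanishes at 1 and has derivative (1 - 1/x)^2 / 2. The bound
    fixes a sign in [zeta_div_sqr_nincr]. *)
Lemma ln_le_half_sub_inv (R : realType) (y : R) : 1 <= y ->
  ln y <= (y - y^-1) / 2.
Proof.
move=> y1.
pose f : R -> R := 2^-1 *: (id - @GRing.inv R) - @ln R.
suff : f 1 <= f y.
  rewrite /f !fctE ln1 invr1 subrr scaler0 subr0 subr_ge0.
  by rewrite [_ *: _]mulrC.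
apply: (@is_derive_ge0_le _ f (fun x => 2^-1 *: (1 - - x ^- 2) - x^-1)).
- exact: y1.
- move=> x /andP[x1 _]; have x0 : 0 < x := lt_le_trans ltr01 x1.
  have := is_derive1_ln x0; have := is_derive_inv (lt0r_neq0 x0) => d1 d2.
  exact: is_deriveB.
- move=> x /andP[x1 _].
  have x0 : x != 0 by rewrite gt_eqF// (lt_le_trans ltr01 x1).
  have -> : 2^-1 *: (1 - - x ^- 2) - x^-1 = (1 - x^-1) ^+ 2 / 2.
    by rewrite /GRing.scale/=; field.
  by rewrite divr_ge0 ?sqr_ge0.
Qed.

(** The derivative is (x - 1)^2 / x. Comparison with the value 0 at 1 bounds t - log (1 + t) by t^2
    / 2, from above for t >= 0 and from below for t <= 0. *)
Lemma ln_sub_half_sqr_mono (R : realType) (y z : R) : 0 < y -> y <= z ->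
  ln y - (y - 1) + (y - 1) ^+ 2 / 2 <= ln z - (z - 1) + (z - 1) ^+ 2 / 2.
Proof.
move=> y0 yz.
pose f : R -> R := @ln R - (id - cst 1) + 2^-1 *: ((id - cst 1) * (id - cst 1)).
have fE x : f x = ln x - (x - 1) + (x - 1) ^+ 2 / 2.
  by rewrite /f !fctE expr2 /GRing.scale/= [2^-1 * _]mulrC.
have fd (x : R) : 0 < x -> is_derive x 1 f ((x - 1) ^+ 2 / x).
  move=> x0; have d1 : is_derive x 1 (id - cst 1 : R -> R) (1 - 0).
    exact: is_deriveB.
  have d2 := is_deriveD (is_deriveB (is_derive1_ln x0) d1)
    (is_deriveZ 2^-1 (is_deriveM d1 d1)).
  apply: (is_derive_eq d2); rewrite /GRing.scale/= !fctE/=; field.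
  by rewrite gt_eqF.
rewrite -!fE; clearbody f.
apply: (is_derive_ge0_le (df := fun x => (x - 1) ^+ 2 / x) yz) => x /andP[yx _].
  exact/fd/(lt_le_trans y0 yx).
by rewrite divr_ge0 ?sqr_ge0 ?ltW ?(lt_le_trans y0 yx).
Qed.

Lemma zeta_le_half_sqr (R : realType) (x : R) : 0 <= x ->
  zeta x <= x ^+ 2 / 2.
Proof.
move=> x0; have x1 : 1 <= 1 + x by rewrite lerDl.
by have := ln_sub_half_sqr_mono ltr01 x1; rewrite ln1 /zeta; lra.
Qed.

Lemma half_sqr_le_sub_ln (R : realType) (x : R) : -1 < x -> x <= 0 ->
  x ^+ 2 / 2 <= x - ln (1 + x).
Proof.
move=> x1 x0; have y0 : 0 < 1 + x by lra.
have y1 : 1 + x <= 1 by lra.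
by have := ln_sub_half_sqr_mono y0 y1; rewrite ln1; lra.
Qed.

Lemma zeta_ge0 (R : realType) (x : R) : 0 <= x -> 0 <= zeta x.
Proof.
by move=> x0; rewrite subr_ge0 le_ln1Dx// (lt_le_trans _ x0)// ltrN10.
Qed.

Lemma zeta_gt0 (R : realType) (x : R) : 0 < x -> 0 < zeta x.
Proof.
move=> x0; have y0 : 0 < 1 + x by rewrite addr_gt0.
have lx : ln (1 + x) != 0 by rewrite gt_eqF// ln_gt0// ltrDl.
by rewrite subr_gt0 -(ltrD2l 1) -{2}(lnK y0) expR_gt1Dx.
Qed.

(** With y = 1 + t, the function - zeta t / t^2 becomes (ln y - (y - 1)) / (y - 1)^2. Its derivative
    is (y - 1/y - 2 ln y) / (y - 1)^3, which is nonnegative for y > 1 by [ln_le_half_sub_inv]. *)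
Lemma zeta_div_sqr_nincr (R : realType) (x c : R) : 0 < x -> x <= c ->
  x ^+ 2 / c ^+ 2 * zeta c <= zeta x.
Proof.
move=> x0 xc; have c0 := lt_le_trans x0 xc.
pose g : R -> R := fun y => y - 1.
pose f : R -> R :=
  (@ln R - (id - cst 1)) * ((@GRing.inv R \o g) * (@GRing.inv R \o g)).
have fE y : 0 < y -> f (1 + y) = - (zeta y / y ^+ 2).
  move=> y0; rewrite /f !fctE /comp /g /zeta.
  have -> : 1 + y - 1 = y by lra.
  by rewrite -invfM -expr2 -mulNr opprB.
pose df (y : R) := (y - y^-1 - 2 * ln y) * (y - 1)^-1 ^+ 3.
have fd (y : R) : 1 < y -> is_derive y 1 f (df y).
  move=> y1; have gy : 0 < g y by rewrite subr_gt0.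
  have y0 := lt_trans ltr01 y1.
  have d1 : is_derive y 1 (id - cst 1 : R -> R) (1 - 0).
    exact: is_deriveB.
  have d2 : is_derive y 1 g 1 by apply: (is_derive_eq d1); rewrite subr0.
  have d3 := is_derive_inv (lt0r_neq0 gy).
  have d4 := @is_derive1_comp _ _ _ _ _ _ d3 d2.
  have d5 := is_deriveM (is_deriveB (is_derive1_ln y0) d1) (is_deriveM d4 d4).
  apply: (is_derive_eq d5); rewrite /df /g /GRing.scale/= !fctE/=; field.
  by rewrite !gt_eqF.
have : f (1 + x) <= f (1 + c).
  clearbody f.
  apply: (is_derive_ge0_le (df := df)) => [|y /andP[xy _]|y /andP[xy _]].
  - by rewrite lerD2l.
  - by apply: fd; lra.
  - have gy : 0 < y - 1 by lra.
    have y1 : 1 <= y by lra.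
    rewrite mulr_ge0 ?exprn_ge0 ?invr_ge0 ?(ltW gy)//.
    by have := ln_le_half_sub_inv y1; lra.
rewrite !fE// lerN2 ler_pdivlMr ?exprn_gt0// => h.
by rewrite -mulrA mulrC [_ * zeta c]mulrC.
Qed.

(** For x > 0 this is the monotonicity of zeta t / t^2. For x < 0 the quantity x^2 / 2 separates the
    two sides, since zeta c <= c^2 / 2. *)
Lemma sub_ln_ge_zeta (R : realType) (x c : R) : -1 < x -> `|x| <= c -> 0 < c ->
  x ^+ 2 / c ^+ 2 * zeta c <= x - ln (1 + x).
Proof.
move=> x1 xc c0; have [x0|x0|->] := ltgtP x 0; last first.
- by rewrite expr0n/= !mul0r addr0 ln1 subrr.
- by apply: zeta_div_sqr_nincr => //; rewrite (le_trans _ xc) ?ler_norm.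
- apply: (le_trans _ (half_sqr_le_sub_ln x1 (ltW x0))).
  rewrite -mulrA ler_wpM2l ?sqr_ge0// mulrC ler_pdivrMr ?exprn_gt0//.
  by rewrite mulrC zeta_le_half_sqr ?ltW.
Qed.

(** * Positive definite matrices *)

Section PositiveDefinite.
Context {R : realType} {d : nat}.
Implicit Types (M W X P : 'M[R]_d) (x : 'rV[R]_d).

Lemma orthogonal_conj_diag1 P x : P *m P^T = 1%:M ->
  (forall i, x 0 i = 1) -> P^T *m diag_mx x *m P = 1%:M.
Proof.
move=> PP x1; suff -> : diag_mx x = 1%:M by rewrite mulmx1 (mulmx1C PP).
by apply/matrixP => i j; rewrite !mxE x1.
Qed.

Lemma orthogonal_conj_diagM P x y : P *m P^T = 1%:M ->
  (P^T *m diag_mx x *m P) *m (P^T *m diag_mx y *m P) =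
  P^T *m diag_mx (\row_i (x 0 i * y 0 i)) *m P.
Proof.
move=> PP; rewrite !mulmxA -(mulmxA _ P) PP mulmx1 -(mulmxA _ (diag_mx x)).
by rewrite mulmx_diag.
Qed.

Lemma det_orthogonal_conj_diag P x : P *m P^T = 1%:M ->
  \det (P^T *m diag_mx x *m P) = \prod_i x 0 i.
Proof.
move=> PP; rewrite !det_mulmx mulrAC -det_mulmx (mulmx1C PP) det1 mul1r.
exact: det_diag.
Qed.

Lemma trace_orthogonal_conj_diag P x : P *m P^T = 1%:M ->
  \tr (P^T *m diag_mx x *m P) = \sum_i x 0 i.
Proof.
by move=> PP; rewrite -mulmxA mxtrace_mulC -mulmxA PP mulmx1 mxtrace_diag.
Qed.

Lemma quad_diag (y x : 'rV[R]_d) :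
  (y *m diag_mx x *m y^T) 0 0 = \sum_i x 0 i * y 0 i ^+ 2.
Proof.
rewrite mxE; apply: eq_bigr => i _.
by rewrite mul_mx_diag !mxE mulrAC -expr2 mulrC.
Qed.

Lemma quad_orthogonal_row P x i : P *m P^T = 1%:M ->
  (row i P *m (P^T *m diag_mx x *m P) *m (row i P)^T) 0 0 = x 0 i.
Proof.
move=> PP; rewrite rowE trmx_mul trmx_delta.
rewrite -!mulmxA (mulmxA P) PP mul1mx (mulmxA P) PP mul1mx -rowE.
by rewrite -colE !mxE eqxx.
Qed.

(** Row i of P tests the eigenvalue x_i. Conversely, the quadratic form at y is the sum of the
    squared coordinates of y P^T with weights x_i. *)
Lemma posdef_orthogonal_conj_diag P x : P *m P^T = 1%:M ->
  posdef (P^T *m diag_mx x *m P) <-> forall i, 0 < x 0 i.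
Proof.
move=> PP; split=> [[_ pd] i|x0].
  rewrite -(quad_orthogonal_row x i PP) pd//; apply/eqP => P0.
  have : row i (P *m P^T) = 0 by rewrite row_mul P0 mul0mx.
  rewrite PP => /rowP/(_ i); rewrite !mxE eqxx => /eqP.
  by rewrite oner_eq0.
split=> [|y y0]; first by rewrite !trmx_mul trmxK tr_diag_mx mulmxA.
have yP0 : y *m P^T != 0.
  apply: contra y0 => /eqP yP; apply/eqP.
  by rewrite -(mulmx1 y) -(mulmx1C PP) mulmxA yP mul0mx.
rewrite !mulmxA -(mulmxA _ P) -{2}(trmxK P) -trmx_mul quad_diag.
rewrite lt_def sumr_ge0 ?andbT => [|i _]; last first.
  by rewrite mulr_ge0 ?sqr_ge0 ?ltW.
apply: contra yP0; rewrite psumr_eq0 => [/allP h|i _]; last first.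
  by rewrite mulr_ge0 ?sqr_ge0 ?ltW.
apply/eqP/rowP => i; have := h i (mem_index_enum _).
by rewrite mulf_eq0 gt_eqF//= sqrf_eq0 => /eqP ->; rewrite mxE.
Qed.

Lemma posdef_det_gt0 M : posdef M -> 0 < \det M.
Proof.
move=> pd; have [P [x [PP ME]]] := real_spectral pd.1.
move: pd; rewrite ME posdef_orthogonal_conj_diag// => x0.
by rewrite det_orthogonal_conj_diag// prodr_gt0.
Qed.

Lemma posdef_unitmx M : posdef M -> M \in unitmx.
Proof. by move=> /posdef_det_gt0 M0; rewrite unitmxE unitfE gt_eqF. Qed.

(** The eigenvalues are nonnegative and their product is positive, so none is zero. This is used for
    sublevel sets, where only closed conditions are at hand. *)
Lemma possemidef_det_gt0_posdef M : M^T = M ->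
  (forall y : 'rV[R]_d, 0 <= (y *m M *m y^T) 0 0) -> 0 < \det M -> posdef M.
Proof.
move=> Msym psd; have [P [x [PP ME]]] := real_spectral Msym.
rewrite ME det_orthogonal_conj_diag// posdef_orthogonal_conj_diag// => x0 i.
rewrite lt_def -(quad_orthogonal_row x i PP) -ME psd ME andbT.
rewrite quad_orthogonal_row//.
by apply: contraTneq x0 => xi; rewrite (bigD1 i)//= xi mul0r ltxx.
Qed.

Lemma posdef_conj M W : posdef M -> W^T = W -> W \in unitmx ->
  posdef (W *m M *m W).
Proof.
move=> [Msym pd] Wsym Wu; split; first by rewrite !trmx_mul Wsym Msym mulmxA.
move=> y y0; have -> : y *m (W *m M *m W) *m y^T = (y *m W) *m M *m (y *m W)^T.
  by rewrite trmx_mul Wsym !mulmxA.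
apply: pd; apply: contra y0 => /eqP yW.
by rewrite -(mulmxK Wu y) yW mul0mx.
Qed.

(** [xget] returns a genuine root once one exists; the witness replaces each eigenvalue x_i of M by
    1 / sqrt x_i. *)
Lemma inv_sqrtmxP M : posdef M ->
  posdef (inv_sqrtmx M) /\ inv_sqrtmx M *m inv_sqrtmx M = invmx M.
Proof.
move=> pd; have Mu := posdef_unitmx pd.
have [P [x [PP ME]]] := real_spectral pd.1.
have x0 : forall i, 0 < x 0 i.
  by move: pd; rewrite ME posdef_orthogonal_conj_diag.
suff [X SX] : exists X, [set X | posdef X /\ X *m X = invmx M] X.
  exact: (@xgetPex _ 0 [set X | posdef X /\ X *m X = invmx M]
    (ex_intro _ X SX)).
pose w i := (Num.sqrt (x 0 i))^-1.
exists (P^T *m diag_mx (\row_i w i) *m P); split.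
  apply/posdef_orthogonal_conj_diag => // i.
  by rewrite mxE invr_gt0 sqrtr_gt0.
apply: (can_inj (mulKmx Mu)); rewrite mulmxV// {1}ME !orthogonal_conj_diagM//.
apply: orthogonal_conj_diag1 => // i.
by rewrite !mxE -invfM -expr2 sqr_sqrtr ?ltW// divff ?gt_eqF.
Qed.

Lemma inv_sqrtmx_conj M : posdef M ->
  inv_sqrtmx M *m M *m inv_sqrtmx M = 1%:M.
Proof.
move=> pd; have [pdW WW] := inv_sqrtmxP pd.
by apply: mulmx1C; rewrite mulmxA WW mulVmx// posdef_unitmx.
Qed.

(** * The Frobenius norm and the Bregman inequality for log det *)

Lemma frobenius_norm_sym X : X^T = X ->
  frobenius_norm X = Num.sqrt (\tr (X *m X)).
Proof.
move=> Xs; congr Num.sqrt; apply: eq_bigr => i _; rewrite mxE.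
by apply: eq_bigr => j _; rewrite -{3}Xs mxE.
Qed.

Lemma frobenius_norm_ge0 X : 0 <= frobenius_norm X.
Proof. exact: sqrtr_ge0. Qed.

Lemma frobenius_norm_eq0 X : frobenius_norm X = 0 -> X = 0.
Proof.
move=> /eqP; rewrite sqrtr_eq0 => X0; apply/matrixP => i j; rewrite mxE.
apply/eqP; rewrite -sqrf_eq0 eq_le sqr_ge0 andbT (le_trans _ X0)//.
rewrite (bigD1 i)//= (bigD1 j)//= -addrA lerDl addr_ge0 ?sumr_ge0// => k _.
  exact: sqr_ge0.
by rewrite sumr_ge0// => l _; exact: sqr_ge0.
Qed.

(** The weights x_i^2 / c^2 sum to 1, so zeta c splits into shares, each bounded by [sub_ln_ge_zeta]
    because |x_i| <= c. The case c = 0, where the weights make no sense, is separate. *)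
Lemma sum_sub_ln_ge_zeta x : (forall i, -1 < x 0 i) ->
  zeta (Num.sqrt (\sum_i x 0 i ^+ 2)) <= \sum_i (x 0 i - ln (1 + x 0 i)).
Proof.
move=> x1; set c := Num.sqrt _.
have c2 : c ^+ 2 = \sum_i x 0 i ^+ 2.
  by rewrite sqr_sqrtr// sumr_ge0// => i _; exact: sqr_ge0.
have [c0|c0] := eqVneq c 0.
  rewrite c0 /zeta addr0 ln1 subrr sumr_ge0// => i _.
  by rewrite subr_ge0 le_ln1Dx.
have {}c0 : 0 < c by rewrite lt_def c0 sqrtr_ge0.
have -> : zeta c = \sum_i x 0 i ^+ 2 / c ^+ 2 * zeta c.
  by rewrite -!mulr_suml -c2 divff ?mul1r// sqrf_eq0 gt_eqF.
apply: ler_sum => i _; apply: sub_ln_ge_zeta => //.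
rewrite -sqrtr_sqr ler_sqrt ?sumr_ge0// => [|j _]; last exact: sqr_ge0.
by rewrite (bigD1 i)//= lerDl sumr_ge0// => j _; exact: sqr_ge0.
Qed.

Lemma ln_prod (I : finType) (f : I -> R) : (forall i, 0 < f i) ->
  ln (\prod_i f i) = \sum_i ln (f i).
Proof.
(* Positivity belongs to the invariant because [lnM] requires it of both factors. *)
move=> f0; pose K (a b : R) := 0 < a /\ ln a = b.
suff [] : K (\prod_i f i) (\sum_i ln (f i)) by [].
apply: (big_ind2 K) => [|a b a' b' [a0 ab] [a'0 ab']|i _]; split => //.
- by rewrite ln1.
- exact: mulr_gt0.
- by rewrite lnM ?posrE// ab ab'.
Qed.

Theorem logdet_bregman_ge M0 M (W := inv_sqrtmx M0) : posdef M0 -> posdef M ->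
  zeta (frobenius_norm (W *m (M - M0) *m W)) <=
  \tr (invmx M0 *m (M - M0)) - ln (\det M) + ln (\det M0).
Proof.
move=> pd0 pd; have [[Wsym pdW] WW] := inv_sqrtmxP pd0.
rewrite -/W in Wsym pdW WW.
have Wu : W \in unitmx by exact: posdef_unitmx (conj Wsym pdW).
pose X := W *m (M - M0) *m W.
have Xs : X^T = X.
  by rewrite !trmx_mul linearB/= Wsym pd.1 pd0.1 mulmxA.
have XE : W *m M *m W = 1%:M + X.
  by rewrite /X mulmxBr mulmxBl inv_sqrtmx_conj// addrC subrK.
have [P [x [PP XP]]] := real_spectral Xs.
pose y := \row_i (1 + x 0 i).
have yP : W *m M *m W = P^T *m diag_mx y *m P.
  have -> : diag_mx y = 1%:M + diag_mx x.
    by apply/matrixP => i j; rewrite !mxE mulrnDl.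
  by rewrite XE mulmxDr mulmxDl mulmx1 (mulmx1C PP) -XP.
(* Conjugation by W preserves positive definiteness, whence 1 + x_i > 0. *)
have y0 i : 0 < y 0 i.
  move: i; apply/(posdef_orthogonal_conj_diag y PP); rewrite -yP.
  exact: posdef_conj.
have detE : \det M = \prod_i y 0 i * \det M0.
  have detW : \det W * \det W * \det M0 = 1.
    by rewrite -det_mulmx WW det_inv mulVf// gt_eqF ?posdef_det_gt0.
  rewrite -(det_orthogonal_conj_diag y PP) -yP !det_mulmx -[LHS]mul1r -detW.
  by ring.
have trE : \tr (invmx M0 *m (M - M0)) = \sum_i x 0 i.
  by rewrite -(trace_orthogonal_conj_diag x PP) -XP -WW -mulmxA mxtrace_mulC.
have frE : frobenius_norm X = Num.sqrt (\sum_i x 0 i ^+ 2).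
  rewrite frobenius_norm_sym// {1 2}XP orthogonal_conj_diagM//.
  rewrite trace_orthogonal_conj_diag//; congr Num.sqrt.
  by apply: eq_bigr => i _; rewrite mxE expr2.
rewrite -/X frE trE detE lnM ?posrE ?prodr_gt0 ?posdef_det_gt0//.
rewrite ln_prod// opprD addrA subrK -sumrB.
have -> : \sum_i (x 0 i - ln (y 0 i)) = \sum_i (x 0 i - ln (1 + x 0 i)).
  by apply: eq_bigr => i _; rewrite mxE.
by apply: sum_sub_ln_ge_zeta => i; have := y0 i; rewrite mxE -ltrBlDl sub0r.
Qed.

End PositiveDefinite.

(** The trace of X^2 is the sum of the squared eigenvalues of X, so each of them exceeds -1. *)
Lemma posdef_one_add (R : realType) (d : nat) (X : 'M[R]_d) : X^T = X ->
  \tr (X *m X) < 1 -> posdef (1%:M + X).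
Proof.
move=> Xs; have [P [x [PP XP]]] := real_spectral Xs.
rewrite {1 2}XP orthogonal_conj_diagM// trace_orthogonal_conj_diag// => X1.
have -> : 1%:M + X = P^T *m diag_mx (\row_i (1 + x 0 i)) *m P.
  have -> : diag_mx (\row_i (1 + x 0 i)) = 1%:M + diag_mx x.
    by apply/matrixP => i j; rewrite !mxE mulrnDl.
  by rewrite mulmxDr mulmxDl mulmx1 (mulmx1C PP) -XP.
apply/posdef_orthogonal_conj_diag => // i; rewrite mxE -ltrBlDl sub0r.
have xi1 : x 0 i ^+ 2 < 1.
  apply: le_lt_trans X1; rewrite (bigD1 i)//= mxE -expr2 lerDl.
  apply: sumr_ge0 => j _.
  by rewrite mxE -expr2 sqr_ge0.
have : `|x 0 i| < 1 by rewrite -sqrtr_sqr -sqrtr1 ltr_sqrt.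
by rewrite ltr_norml => /andP[].
Qed.

Lemma logdet_bregman_gt0 (R : realType) (d : nat) (M0 M : 'M[R]_d) :
  posdef M0 -> posdef M -> M != M0 ->
  0 < \tr (invmx M0 *m (M - M0)) - ln (\det M) + ln (\det M0).
Proof.
move=> pd0 pd MM0; apply: lt_le_trans (logdet_bregman_ge pd0 pd).
apply: zeta_gt0; rewrite lt_def frobenius_norm_ge0 andbT.
apply: contra MM0 => /eqP/frobenius_norm_eq0 W0.
have Wu := posdef_unitmx (inv_sqrtmxP pd0).1.
rewrite -subr_eq0 -(mulKmx Wu (M - M0)) -(mulmxK Wu (_ *m (M - M0))) W0.
by rewrite mul0mx mulmx0.
Qed.

(** * Smoothness *)

Section ElementaryFunctions.
Context {R : realType} {n : nat} (E : set 'rV[R]_n).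
Implicit Types (f g u : 'rV[R]_n -> R) (p v : 'rV[R]_n).

(** A class of functions differentiable at the points of E and stable, up to equality on E, under
    directional derivatives; smoothness of all orders then follows by induction. The side conditions
    keep reciprocals and logarithms away from their singularities. *)
Inductive elementary : ('rV[R]_n -> R) -> Prop :=
| elementary_cst c : elementary (cst c)
| elementary_coord i : elementary (fun p => p 0 i)
| elementary_add f g : elementary f -> elementary g -> elementary (f + g)
| elementary_mul f g : elementary f -> elementary g -> elementary (f * g)
| elementary_inv f : (forall p, E p -> f p != 0) -> elementary f ->
    elementary (fun p => (f p)^-1)
| elementary_ln f : (forall p, E p -> 0 < f p) -> elementary f ->
    elementary (@ln R \o f).

Lemma elementary_opp f : elementary f -> elementary (- f).
Proof.
move=> ef; rewrite (_ : - f = cst (-1) * f); last first.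
  by apply/funext => p; rewrite !fctE mulN1r.
by apply: elementary_mul => //; exact: elementary_cst.
Qed.

Lemma elementary_sum (I : Type) (r : seq I) (P : pred I)
    (F : I -> 'rV[R]_n -> R) : (forall i, elementary (F i)) ->
  elementary (fun p => \sum_(i <- r | P i) F i p).
Proof.
move=> eF; rewrite (_ : (fun _ => _) = \sum_(i <- r | P i) F i); last first.
  by apply/funext => p; rewrite fct_sumE.
by apply: big_ind => [|f g|i _]; [exact: elementary_cst|exact: elementary_add|].
Qed.

Lemma elementary_prod (I : Type) (r : seq I) (P : pred I)
    (F : I -> 'rV[R]_n -> R) : (forall i, elementary (F i)) ->
  elementary (fun p => \prod_(i <- r | P i) F i p).
Proof.
move=> eF; elim: r => [|i r IHr].
  rewrite (_ : (fun _ => _) = cst 1); first exact: elementary_cst.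
  by apply/funext => p; rewrite big_nil.
have [Pi|Pi] := boolP (P i); last first.
  rewrite (_ : (fun _ => _) = fun p => \prod_(i <- r | P i) F i p)//.
  by apply/funext => p; rewrite big_cons (negbTE Pi).
rewrite (_ : (fun _ => _) = F i * fun p => \prod_(i <- r | P i) F i p).
  exact: elementary_mul.
by apply/funext => p; rewrite big_cons Pi.
Qed.

Lemma elementary_det m (M : 'rV[R]_n -> 'M[R]_m) :
  (forall i j, elementary (fun p => M p i j)) ->
  elementary (fun p => \det (M p)).
Proof.
move=> eM; apply: elementary_sum => s.
rewrite (_ : (fun _ => _) = cst ((-1) ^+ perm.odd_perm s) *
  fun p => \prod_i M p i (perm.fun_of_perm s i))//.
by apply: elementary_mul; [exact: elementary_cst|exact: elementary_prod].
Qed.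

Lemma elementary_differentiable f p : elementary f -> E p -> differentiable f p.
Proof.
move=> ef Ep; elim: ef => {f}
  [c|i|f g _ df _ dg|f g _ df _ dg|f f0 _ df|f f0 _ df].
- exact: differentiable_cst.
- exact: differentiable_coord.
- exact: differentiableD.
- exact: differentiableM.
- by apply: differentiableV => //; exact: f0.
- apply: differentiable_comp => //; apply/derivable1_diffP.
  exact: (@ex_derive _ _ _ _ _ _ _ (is_derive1_ln (f0 _ Ep))).
Qed.

Lemma derive_coord i p v : 'D_v (fun q : 'rV[R]_n => q 0 i) p = v 0 i.
Proof.
have := derive_mx (@diff_derivable R _ _ id p v _).
rewrite deriveE// diff_val => /(_ (ltac:(by [])))/matrixP/(_ 0 i).
by rewrite mxE => <-.
Qed.

Lemma derive_ln_comp f p v : differentiable f p -> 0 < f p ->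
  'D_v (@ln R \o f) p = (f p)^-1 * 'D_v f p.
Proof.
move=> df f0; have dln := is_derive1_ln f0.
have dl : differentiable (@ln R) (f p).
  by apply/derivable1_diffP; exact: ex_derive.
rewrite deriveE; last exact: differentiable_comp.
rewrite diff_comp//= deriv1E; last exact: ex_derive.
by rewrite -deriveE// derive1E derive_val [LHS]mulrC.
Qed.

Lemma elementary_derive f v : elementary f ->
  exists2 g, elementary g & forall p, E p -> 'D_v f p = g p.
Proof.
elim=> {f} [c|i|f g ef [df edf fE] eg [dg edg gE]
  |f g ef [df edf fE] eg [dg edg gE]|f f0 ef [df edf fE]|f f0 ef [df edf fE]].
- by exists (cst 0); [exact: elementary_cst|move=> p _; rewrite derive_cst].
- exists (cst (v 0 i)); first exact: elementary_cst.
  by move=> p _; exact: derive_coord.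
- exists (df + dg); first exact: elementary_add.
  move=> p Ep; rewrite deriveD ?fE ?gE//; apply/diff_derivable;
    exact: elementary_differentiable.
- exists (f * dg + g * df).
    by apply: elementary_add; exact: elementary_mul.
  move=> p Ep; rewrite deriveM ?fE ?gE//; apply/diff_derivable;
    exact: elementary_differentiable.
- exists ((- ((fun p => (f p)^-1) * (fun p => (f p)^-1))) * df).
    apply: elementary_mul => //; apply: elementary_opp.
    by apply: elementary_mul; exact: elementary_inv.
  move=> p Ep; rewrite deriveV ?fE ?f0//; last first.
    exact/diff_derivable/elementary_differentiable.
  by rewrite !fctE expr2 invfM.
- exists ((fun p => (f p)^-1) * df).
    apply: elementary_mul => //; apply: elementary_inv => // p Ep.
    by rewrite gt_eqF ?f0.
  move=> p Ep; rewrite derive_ln_comp ?fE ?f0//.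
  exact: elementary_differentiable.
Qed.

End ElementaryFunctions.

(* Unlike near_eq_derive, equality is only assumed along the line: a function
   extended by 0 off a relatively open subset of an affine subspace agrees with
   its smooth model on no neighbourhood. *)
Lemma derive_eq_on_line (R : realType) (V : normedModType R) (u g : V -> R)
    (p v : V) :
  (\forall t \near (0 : R), u (t *: v + p) = g (t *: v + p)) ->
  derivable g p v -> derivable u p v /\ 'D_v u p = 'D_v g p.
Proof.
move=> ug dg; have ugp : u p = g p.
  by have := nbhs_singleton ug; rewrite scale0r add0r.
have near_eq : \forall t \near (0 : R)^', t^-1 *: (u (t *: v + p) - u p) =
    t^-1 *: (g (t *: v + p) - g p).
  by apply/cvg_within; apply: filterS ug => t ->; rewrite ugp.
have E : 'D_v u p = 'D_v g p.
  rewrite /derive; congr (lim _); rewrite eqEsubset.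
  split; apply: near_eq_cvg => //.
  by apply: filterS near_eq => t ->.
split=> //; apply/cvg_ex; move/cvg_ex: dg => [l gl]; exists l.
apply: cvg_trans gl; by apply: near_eq_cvg; apply: filterS near_eq => t ->.
Qed.

(** By induction on the list of directions, each iterated derivative of u agrees on E with an
    elementary function. Lines in directions of T stay in E for small t, so [derive_eq_on_line]
    transfers one more derivative. *)
Lemma elementary_smooth_on (R : realType) (n : nat) (T E : set 'rV[R]_n)
    (g u : 'rV[R]_n -> R) :
  (forall p v, E p -> T v -> \forall t \near (0 : R), E (t *: v + p)) ->
  elementary E g -> (forall p, E p -> u p = g p) -> smooth_on T E u.
Proof.
move=> ET eg ug s sT.
have [w ew uw] : exists2 w, elementary E w &
    forall p, E p -> iter_derive s u p = w p.
  elim: s sT => [_|v s IHs sT]; first by exists g.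
  have [|w ew uw] := IHs.
    by move=> v' v's; apply: sT; rewrite inE v's orbT.
  have [w' ew' ww'] := elementary_derive v ew.
  exists w' => // p Ep; rewrite -ww'//.
  have Tv : T v by apply: sT; rewrite mem_head.
  apply: (derive_eq_on_line _ _).2.
    by apply: filterS (ET p v Ep Tv) => t /uw.
  exact/diff_derivable/(elementary_differentiable ew).
split.
  apply: (@subspace_eq_continuous _ _ _ w) => [p /[!inE] Ep|].
    exact/esym/uw.
  apply: continuous_in_subspaceT => p /[!inE] Ep.
  exact/differentiable_continuous/(elementary_differentiable ew).
move=> p v Ep Tv; apply: (@derive_eq_on_line _ _ _ w p v _ _).1.
  by apply: filterS (ET p v Ep Tv) => t /uw.
exact/diff_derivable/(elementary_differentiable ew).
Qed.

(** * Optimal designs *)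

Section InformationMatrix.
Context {R : realType} {n d : nat} (A : 'M[R]_(n, d)).
Implicit Types (p q delta : 'rV[R]_n) (S : {set 'I_n}).

Lemma info_is_linear : linear (info A).
Proof.
move=> a p q; rewrite /info scaler_sumr -big_split/=; apply: eq_bigr => i _.
by rewrite !mxE scalerDl scalerA.
Qed.

HB.instance Definition _ :=
  GRing.isLinear.Build R 'rV[R]_n 'M[R]_d _ (info A) info_is_linear.

Lemma info_sym p : (info A p)^T = info A p.
Proof.
rewrite raddf_sum/=; apply: eq_bigr => i _.
by rewrite linearZ/= /rank1 trmx_mul trmxK.
Qed.

Lemma posdef_info_convex p q (t : R) : 0 <= t <= 1 ->
  posdef (info A p) -> posdef (info A q) ->
  posdef (info A (t *: p + (1 - t) *: q)).
Proof.
move=> /andP[t0 t1] [_ pdp] [_ pdq]; split; first exact: info_sym.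
move=> x x0; rewrite linearD !linearZ/= mulmxDr mulmxDl mxE -!scalemxAr.
rewrite -!scalemxAl [X in X + _]mxE [X in _ + X]mxE.
(* One of the two weights must be positive: that of q when t = 0, that of p otherwise. *)
have [<-|t0'] := eqVneq 0 t; first by rewrite mul0r add0r subr0 mul1r pdq.
rewrite ltr_pwDl// ?mulr_gt0 ?pdp ?mulr_ge0 ?subr_ge0// ?ltW ?pdq//.
by rewrite lt_def eq_sym t0'.
Qed.

Lemma elementary_info (E : set 'rV[R]_n) i j :
  elementary E (fun p => info A p i j).
Proof.
rewrite (_ : (fun p => info A p i j) = fun p => \sum_k p 0 k * rank1 A k i j).
  apply: elementary_sum => k; apply: (@elementary_mul _ _ _ _ (cst _)).
    exact: elementary_coord.
  exact: elementary_cst.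
by apply/funext => p; rewrite summxE; apply: eq_bigr => k _; rewrite mxE.
Qed.

Lemma elementary_mulmx (E : set 'rV[R]_n) m1 m2 m3
    (M : 'rV[R]_n -> 'M[R]_(m1, m2)) (N : 'rV[R]_n -> 'M[R]_(m2, m3)) :
  (forall i j, elementary E (fun p => M p i j)) ->
  (forall i j, elementary E (fun p => N p i j)) ->
  forall i j, elementary E (fun p => (M p *m N p) i j).
Proof.
move=> eM eN i j.
rewrite (_ : (fun p => _) = fun p => \sum_k M p i k * N p k j).
  by apply: elementary_sum => k; exact: elementary_mul.
by apply/funext => p; rewrite mxE.
Qed.

Lemma elementary_continuous (f : 'rV[R]_n -> R) :
  elementary setT f -> continuous f.
Proof.
move=> ef p.
exact/differentiable_continuous/(elementary_differentiable ef).
Qed.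

Lemma elementary_objective (E : set 'rV[R]_n) :
  (forall p, E p -> posdef (info A p)) -> elementary E (objective A).
Proof.
move=> Epd; apply: elementary_opp.
apply: (@elementary_ln _ _ _ (fun p => \det (info A p))) => [p Ep|].
  exact/posdef_det_gt0/Epd.
exact/elementary_det/elementary_info.
Qed.

(** With W the inverse square root of [info A p], W (info q) W = 1 + X q. The trace of (X q)^2 is
    continuous in q and vanishes at p, so near p it is below 1 and [posdef_one_add] applies;
    conjugating back by the inverse of W finishes. *)
Lemma open_posdef_info : open [set p | posdef (info A p)].
Proof.
rewrite openE => p /= pdp; have [pdW WW] := inv_sqrtmxP pdp.
set W := inv_sqrtmx _ in pdW WW; have Wu := posdef_unitmx pdW.
pose X q := W *m info A (q - p) *m W.
pose g q := \tr (X q *m X q).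
have eX i j : elementary setT (fun q => X q i j).
  apply: elementary_mulmx; last by move=> *; exact: elementary_cst.
  apply: elementary_mulmx => [*|k l]; first exact: elementary_cst.
  rewrite (_ : (fun q => _) = (fun q => info A q k l) + cst (- info A p k l)).
    by apply: elementary_add; [exact: elementary_info|exact: elementary_cst].
  by apply/funext => q; rewrite raddfB !mxE.
have cg : continuous g.
  apply: elementary_continuous; apply: elementary_sum => i.
  exact: elementary_mulmx.
have gp : g p = 0 by rewrite /g /X subrr linear0 mulmx0 mul0mx mulmx0 mxtrace0.
have : \forall q \near p, g q < 1.
  by apply: (cvgr_lt _ (cg p)); rewrite gp ltr01.
apply: filterS => q gq /=.
have XE : 1%:M + X q = W *m info A q *m W.
  by rewrite /X linearB/= mulmxBr mulmxBl inv_sqrtmx_conj// addrC subrK.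
have -> : info A q = invmx W *m (1%:M + X q) *m invmx W.
  by rewrite XE !mulmxA mulVmx// mul1mx mulmxK.
apply: posdef_conj; first apply: posdef_one_add => //.
- by rewrite !trmx_mul info_sym pdW.1 mulmxA.
- by rewrite trmx_inv pdW.1.
- by rewrite unitmx_inv.
Qed.

Lemma continuous_quad_info (y : 'rV[R]_d) :
  continuous (fun p => (y *m info A p *m y^T) 0 0).
Proof.
apply: elementary_continuous.
apply: elementary_mulmx => *; last exact: elementary_cst.
by apply: elementary_mulmx => *; [exact: elementary_cst|exact: elementary_info].
Qed.

(** Cyclicity of the trace. It expresses the linear term of the Bregman divergence through the
    scores, where the condition v_i = d can be used. *)
Lemma tr_invmx_info_mul p delta :
  \tr (invmx (info A p) *m info A delta) = \sum_i delta 0 i * vscore A p i.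
Proof.
rewrite /info mulmx_sumr raddf_sum/=; apply: eq_bigr => i _.
rewrite -scalemxAr mxtraceZ /rank1 mulmxA mxtrace_mulC mulmxA; congr (_ * _).
by rewrite /mxtrace big_ord1.
Qed.

Lemma supp_subsetP S p :
  reflect (forall i, i \notin S -> p 0 i = 0) (supp p \subset S).
Proof.
apply: (iffP fintype.subsetP) => pS i.
  by move=> iS; apply: contraNeq iS => pi; apply: pS; rewrite inE.
by rewrite inE; apply: contraNT => /pS/eqP.
Qed.

Lemma free_rank1_info_eq0 S delta : free [seq rank1 A i | i in S] ->
  supp delta \subset S -> info A delta = 0 -> delta = 0.
Proof.
move=> frS dS; pose s := in_tuple [seq rank1 A i | i in S].
have szs : size [seq rank1 A i | i in S] = size (enum S) by rewrite size_map.
move=> I0; apply/rowP => i; rewrite mxE.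
have [iS|] := boolP (i \in S); last exact/supp_subsetP.
(* [freeP] numbers coefficients by position in the list, so delta is read through [enum S]. *)
have /freeP/(_ (fun k => delta 0 (nth i (enum S) k))) : free s by [].
have is_ : (index i (enum S) < size [seq rank1 A i | i in S])%N.
  by rewrite szs index_mem mem_enum.
move=> /(_ _ (Ordinal is_)) /=; rewrite nth_index ?mem_enum//; apply.
rewrite -[RHS]I0 /info (bigID (mem S))/= [X in _ + X]big1 ?addr0; last first.
  by move=> j jS; rewrite (supp_subsetP _ _ dS) ?scale0r.
rewrite -[RHS]big_enum/= (big_nth i) -szs big_mkord; apply: eq_bigr => k _.
by rewrite (nth_map i)// -szs.
Qed.

End InformationMatrix.

(** Fermat's rule for phi t = f (p + t v) on an interval around 0. Minimality is asked along the
    line only, since [pstar] will be known to minimize on an affine slice. *)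
Lemma derive_at_line_min (R : realType) (n : nat) (f : 'rV[R]_n -> R)
    (p v : 'rV[R]_n) : differentiable f p ->
  (\forall t \near (0 : R), derivable f (t *: v + p) v) ->
  (\forall t \near (0 : R), f p <= f (t *: v + p)) -> 'D_v f p = 0.
Proof.
move=> dfp dft fmin; pose phi (t : R) := f (t *: v + p).
have : \forall t \near (0 : R), derivable phi t 1 /\ phi 0 <= phi t.
  apply: filterS2 dft fmin => t dt ft; split; last first.
    by rewrite /phi scale0r add0r.
  move: dt; rewrite /derivable (_ : (fun _ => _) =
    fun h => h^-1 *: ((phi \o shift t) (h *: 1) - phi t))//.
  by apply/funext => h; rewrite /phi /= [_%:A]mulr1 addrA -scalerDl.
move=> /nbhs_ballP[e /= e0 he].
have he' t : t \in `]-e, e[ -> derivable phi t 1 /\ phi 0 <= phi t.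
  by rewrite in_itv/= => te; have /he : ball (0 : R) e t
    by rewrite /ball/= sub0r normrN ltr_norml.
have := @derive1_at_min R phi (- e) e 0 _ (fun t te => (he' t te).1) _
  (fun t te => (he' t te).2).
rewrite in_itv/= oppr_lt0 e0 => /(_ _ isT) [|_ <-].
  by rewrite ge0_cp// ltW.
rewrite /derive.
suff -> : (fun h => h^-1 *: ((phi \o shift 0) (h *: 1) - phi 0)) =
  (fun h => h^-1 *: ((f \o shift p) (h *: v) - f p)) by [].
by apply/funext => h /=; rewrite /phi addr0 scale0r add0r [_%:A]mulr1.
Qed.

Lemma inner_gradient (R : realType) (n : nat) (f : 'rV[R]_n -> R)
    (p v : 'rV[R]_n) : differentiable f p -> inner (gradient f p) v = 'D_v f p.
Proof.
move=> df; rewrite deriveE// [in RHS](row_sum_delta v) linear_sum/=.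
by apply: eq_bigr => i _; rewrite linearZ/= mxE deriveE// mulrC.
Qed.

(** * The domain D, the function h and its minimizer *)

Section Design.
Context {R : realType} {n d : nat} (A : 'M[R]_(n, d)) (pstar : 'rV[R]_n).
Implicit Types (p q delta : 'rV[R]_n).
Let S := Sstar A pstar.
Let V := Vaff A pstar.
Let T := Tstar A pstar.
Let D := Dom A pstar.
Let f := objective A.
Let h := hfun A pstar.

Lemma hfunE p : D p -> h p = f p.
Proof. by move=> Dp; rewrite /h /hfun patchE mem_set. Qed.

Lemma Vaff_conv p q (t : R) : V p -> V q -> V (t *: p + (1 - t) *: q).
Proof.
move=> [/supp_subsetP pS p1] [/supp_subsetP qS q1]; split.
  by apply/supp_subsetP => i iS; rewrite !mxE pS// qS// !mulr0 addr0.
under eq_bigr do rewrite !mxE.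
by rewrite big_split/= -!mulr_sumr p1 q1 !mulr1 subrKC.
Qed.

Lemma Vaff_sub p q : V p -> V q -> T (p - q).
Proof.
move=> [/supp_subsetP pS p1] [/supp_subsetP qS q1]; split.
  by apply/supp_subsetP => i iS; rewrite !mxE pS// qS// subr0.
under eq_bigr do rewrite !mxE.
by rewrite sumrB p1 q1 subrr.
Qed.

Lemma Vaff_line p delta (t : R) : V p -> T delta -> V (t *: delta + p).
Proof.
move=> [/supp_subsetP pS p1] [/supp_subsetP dS d0]; split.
  by apply/supp_subsetP => i iS; rewrite !mxE pS// dS// mulr0 addr0.
under eq_bigr do rewrite !mxE.
by rewrite big_split/= -mulr_sumr d0 mulr0 add0r.
Qed.

Lemma Dom_conv p q (t : R) : 0 <= t <= 1 -> D p -> D q ->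
  D (t *: p + (1 - t) *: q).
Proof.
move=> t01 [Vp pdp] [Vq pdq]; split; first exact: Vaff_conv.
exact: posdef_info_convex.
Qed.

Lemma Dom_open : open_in V D.
Proof.
by exists [set p | posdef (info A p)]; split=> //; exact: open_posdef_info.
Qed.

Lemma Dom_convex : convex_set D.
Proof.
move=> p q t /set_mem Dp /set_mem Dq; apply/mem_set.
by apply: Dom_conv => //; rewrite ge0 le1.
Qed.

Lemma Dom_line p delta : D p -> T delta ->
  \forall t \near (0 : R), D (t *: delta + p).
Proof.
move=> [Vp pdp] Td.
have cl : continuous (fun t : R => t *: delta + p).
  by move=> t; apply: cvgD; [exact: cvgZr_tmp|exact: cvg_cst].
have : \forall t \near (0 : R), posdef (info A (t *: delta + p)).
  apply: (cl 0 [set p | posdef (info A p)]); apply: open_nbhs_nbhs.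
  split; first exact: open_posdef_info.
  by rewrite /= scale0r add0r.
by apply: filterS => t pdt; split=> //; exact: Vaff_line.
Qed.

Lemma hfun_smooth : smooth_on T D h.
Proof.
apply: (@elementary_smooth_on _ _ _ _ f); first exact: Dom_line.
  by apply: elementary_objective => p [].
exact: hfunE.
Qed.

Lemma Vaff_closed : closed V.
Proof.
rewrite (_ : V = (\bigcap_(i in [set i | i \notin S]) [set p | p 0 i = 0]) `&`
    [set p | \sum_i p 0 i = 1]).
  apply: closedI; first apply: closed_bigI => i _.
    apply: (@preimage_closed _ _ (fun p : 'rV[R]_n => p 0 i)
      [set x | x = 0]) => [p _|].
      exact: coord_continuous.
    exact: closed_eq.
  apply: (@preimage_closed _ _ (fun p : 'rV[R]_n => \sum_i p 0 i)
    [set x | x = 1]) => [p _|].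
    apply: elementary_continuous; apply: elementary_sum => i.
    exact: elementary_coord.
  exact: closed_eq.
apply/seteqP; split=> p [pS p1]; split => //; last exact/supp_subsetP.
by move=> i; exact/supp_subsetP.
Qed.

Lemma hfun_closed : closed_on D h.
Proof.
move=> c; rewrite (_ : [set p | D p /\ h p <= c] = V `&`
  (\bigcap_(y in [set: 'rV[R]_d]) [set p | 0 <= (y *m info A p *m y^T) 0 0]) `&`
  [set p | expR (- c) <= \det (info A p)]).
  apply: closedI; first apply: closedI; first exact: Vaff_closed.
  - apply: closed_bigI => y _.
    apply: (@preimage_closed _ _ (fun p => (y *m info A p *m y^T) 0 0)
      [set x : R | 0 <= x]).
      by move=> p _; exact: continuous_quad_info.
    exact: closed_ge.
  - apply: (@preimage_closed _ _ (fun p => \det (info A p))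
      [set x : R | expR (- c) <= x]).
      move=> p _; apply: elementary_continuous.
      exact/elementary_det/elementary_info.
    exact: closed_ge.
apply/seteqP; split=> p.
  move=> [Dp]; rewrite hfunE// => fc; have [Vp pd] := Dp; split; last first.
    by rewrite /= -(lnK (posdef_det_gt0 pd)) ler_expR lerNl.
  split=> // y _ /=; have [->|y0] := eqVneq y 0.
    by rewrite !mul0mx mxE.
  by rewrite ltW// pd.2.
move=> [[Vp psd] detc].
have det0 : 0 < \det (info A p) by exact: lt_le_trans (expR_gt0 _) detc.
have Dp : D p.
  split=> //; apply: possemidef_det_gt0_posdef => // [|y].
    exact: info_sym.
  exact: psd.
by split=> //; rewrite hfunE// lerNl -ler_expR lnK.
Qed.

Context (nondeg : nondegenerate_design A pstar) (opt : optimal_design A pstar).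

(** Linear independence of the a_i a_i^T enters here: p - q is supported on [Sstar]. *)
Lemma info_inj p q : V p -> V q -> info A p = info A q -> p = q.
Proof.
move=> Vp Vq /eqP; rewrite -subr_eq0 -linearB => /eqP I0.
apply/eqP; rewrite -subr_eq0; apply/eqP.
have [_ _ frS] := nondeg; apply: (free_rank1_info_eq0 frS) => //.
by case: (Vaff_sub Vp Vq).
Qed.

Lemma hfun_strictly_convex : strictly_convex_on D h.
Proof.
move=> p q t Dp Dq pq /andP[t0 t1]; set z := _ + _.
have Dz : D z by apply: Dom_conv => //; rewrite !ltW.
rewrite !hfunE//; have [[Vp pdp] [Vq pdq] [Vz pdz]] := And3 Dp Dq Dz.
(* As p - z = (1 - t) (p - q) is nonzero, the inequality based at z is strict at p; the weak one at
   q then suffices. *)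
have pz : info A p != info A z.
  apply: contra pq => /eqP/(info_inj Vp Vz) pz.
  have : (1 - t) *: (p - q) = p - z by apply/rowP => i; rewrite !mxE; ring.
  move=> /eqP; rewrite {2}pz subrr scaler_eq0.
  rewrite [_ - t == _]subr_eq0 (gt_eqF t1)/=.
  by rewrite subr_eq0.
have := logdet_bregman_gt0 pdz pdp pz.
have := logdet_bregman_ge pdz pdq.
move=> /(le_trans (zeta_ge0 (frobenius_norm_ge0 _))).
rewrite -/(f _) -!linearB => Hq Hp.
(* The weighted mean of p - z and q - z is zero, so the linear terms cancel. *)
have trE : t * \tr (invmx (info A z) *m info A (p - z)) +
    (1 - t) * \tr (invmx (info A z) *m info A (q - z)) = 0.
  rewrite -!mxtraceZ -mxtraceD !scalemxAr -mulmxDr -!linearZ -linearD/=.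
  rewrite !scalerBr addrACA -opprD -scalerDl subrKC scale1r -/z subrr.
  by rewrite linear0 mulmx0 mxtrace0.
have : 0 < t * (\tr (invmx (info A z) *m info A (p - z)) -
      ln (\det (info A p)) + ln (\det (info A z))) +
    (1 - t) * (\tr (invmx (info A z) *m info A (q - z)) -
      ln (\det (info A q)) + ln (\det (info A z))).
  by rewrite ltr_pwDl ?mulr_gt0// mulr_ge0// subr_ge0 ltW.
rewrite /f /objective; move: trE; move: (\tr _) (\tr _) => a b; nra.
Qed.

Lemma pstar_Dom : D pstar.
Proof.
have [[[_ p1] pd] _] := opt; have [suppS _ _] := nondeg.
by split=> //; split=> //; rewrite suppS.
Qed.

Lemma objective_gap p : D p -> f pstar + zeta (rho A pstar p) <= h p.
Proof.
move=> Dp; rewrite hfunE//; have [[Vp pdp] [Vs pds]] := conj Dp pstar_Dom.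
have := logdet_bregman_ge pds pdp; rewrite -linearB tr_invmx_info_mul.
have [/supp_subsetP dS d0] := Vaff_sub Vp Vs.
(* Each score is d on [Sstar] and p - pstar vanishes off it, so the sum is d times the coordinate
   sum of p - pstar, which is 0. *)
rewrite (_ : \sum_i _ = 0); last first.
  rewrite (eq_bigr (fun i => (p - pstar) 0 i * d%:R)) => [|i _].
    by rewrite -mulr_suml d0 mul0r.
  have [|iS] := boolP (i \in S); first by rewrite inE => /eqP ->.
  by rewrite dS// !mul0r.
by rewrite linearB /rho /f /objective; lra.
Qed.

(** Minimality follows from [objective_gap] and zeta >= 0. At the midpoint of two distinct
    minimizers, strict convexity would give a smaller value. *)
Lemma pstar_minimizer p : is_minimizer D h p <-> p = pstar.
Proof.
have Ds := pstar_Dom; have smin q : D q -> h pstar <= h q.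
  move=> Dq; apply: le_trans (objective_gap Dq); rewrite hfunE// lerDl.
  exact/zeta_ge0/frobenius_norm_ge0.
split=> [[Dp pmin]|->]; last by split.
apply/eqP/negPn/negP => pps.
have := hfun_strictly_convex Dp Ds pps (t := 2^-1).
have t01 : 0 < (2^-1 : R) < 1 by apply/andP; split; lra.
have t01' : 0 <= (2^-1 : R) <= 1 by apply/andP; split; lra.
move=> /(_ t01); rewrite ltNge => /negP; apply.
have := pmin _ Ds; have := smin _ (Dom_conv t01' Dp Ds).
lra.
Qed.

Lemma objective_differentiable : differentiable f pstar.
Proof.
have Ds := pstar_Dom; apply: (@elementary_differentiable _ _ D) => //.
by apply: elementary_objective => p [].
Qed.

(** Stationarity is deduced from minimality over D, itself obtained from the gap inequality: D
    contains a two-sided segment through [pstar] in direction delta, on which f is minimal at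
    [pstar]. *)
Lemma gradient_orthogonal delta : T delta -> inner (gradient f pstar) delta = 0.
Proof.
move=> Td; rewrite inner_gradient; last exact: objective_differentiable.
have Dt := Dom_line pstar_Dom Td.
apply: derive_at_line_min; first exact: objective_differentiable.
  apply: filterS Dt => t Dt; apply/diff_derivable.
  apply: (@elementary_differentiable _ _ D) => //.
  by apply: elementary_objective => p [].
apply: filterS Dt => t Dt; rewrite -!hfunE//; last exact: pstar_Dom.
by have [_] := (pstar_minimizer pstar).2 erefl; apply.
Qed.

End Design.

Theorem lemma4p5 (R : realType) (n d : nat) (A : 'M[R]_(n, d))
    (pstar : 'rV[R]_n) (rankA : \rank A = d)
    (opt : optimal_design A pstar) (nondeg : nondegenerate_design A pstar) :
  let V := Vaff A pstar in
  let T := Tstar A pstar in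
  let D := Dom A pstar in
  let f := objective A in
  let h := hfun A pstar in
  [/\ [/\ open_in V D, convex_set D, smooth_on T D h,
          strictly_convex_on D h & closed_on D h],
      [/\ differentiable f pstar,
          (forall delta, T delta -> inner (gradient f pstar) delta = 0) &
          (forall p, is_minimizer D h p <-> p = pstar)] &
      (forall p, D p -> f pstar + zeta (rho A pstar p) <= h p)].
Proof.
split; [split|split|].
- exact: Dom_open.
- exact: Dom_convex.
- exact: hfun_smooth.
- exact: hfun_strictly_convex.
- exact: hfun_closed.
- exact: objective_differentiable.
- exact: gradient_orthogonal.
- exact: pstar_minimizer.
- exact: objective_gap.
Qed.
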